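(* For every integer $n\geq 2$, there is a Hamilton cycle in the $n$-dimensional hypercube $Q_n$ that contains every edge of every chain of the Greene–Kleitman symmetric chain decomposition of $Q_n$.
   Context: $Q_n$ is the graph on all $\{0,1\}$-strings of length $n$, adjacent iff differing in exactly one position; level $k$ is the set of strings with exactly $k$ ones. A symmetric chain is a path $(x_k,x_{k+1},\ldots,x_{n-k})$ in $Q_n$ with $x_i$ in level $i$ for all $i$; a symmetric chain decomposition is a partition of the vertex set of $Q_n$ into symmetric chains. The Greene–Kleitman symmetric chain decomposition is defined as follows: for a vertex $x$, interpret each $0$ as an opening bracket and each $1$ as a closing bracket and match closest pairs of opening and closing brackets in the usual way; the chain containing $x$ is obtained by repeatedly flipping the leftmost unmatched $0$ to $1$ (to ascend) or the rightmost unmatched $1$ to $0$ (to descend), until no unmatched bit can be flipped in that direction. *)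

(* Defs.v *)
From mathcomp Require Import all_boot.
Set Implicit Arguments. Unset Strict Implicit. Unset Printing Implicit Defensive.

(* Vertices of Q_n: 0/1-strings of length n, as n-tuples of booleans
   (false = 0, true = 1), positions 0..n-1 from left to right. *)
Definition vertex (n : nat) := n.-tuple bool.

Definition qadj (n : nat) (x y : vertex n) : bool :=
  #|[set j : 'I_n | tnth x j != tnth y j]| == 1.

Definition flip (n : nat) (x : vertex n) (i : nat) : vertex n :=
  [tuple (if val j == i then ~~ tnth x j else tnth x j) | j < n].

(* Bracket matching: 0 = '(' , 1 = ')'. Scanning left to right with a stack
   of positions of currently unmatched 0s; a 1 is matched with the closest
   unmatched 0 to its left (top of stack), if any.  Returns
   (positions of unmatched 0s, positions of unmatched 1s). *)
Fixpoint bscan (s : seq bool) (i : nat) (st : seq nat) : seq nat * seq nat :=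
  match s with
  | [::] => (st, [::])
  | false :: s' => bscan s' i.+1 (i :: st)
  | true :: s' =>
      match st with
      | [::] => let p := bscan s' i.+1 [::] in (p.1, i :: p.2)
      | _ :: st' => bscan s' i.+1 st'
      end
  end.

Definition unmatched0 (n : nat) (x : vertex n) : seq nat := (bscan x 0 [::]).1.
Definition unmatched1 (n : nat) (x : vertex n) : seq nat := (bscan x 0 [::]).2.

Definition gk_up (n : nat) (x : vertex n) : option (vertex n) :=
  match unmatched0 x with
  | [::] => None
  | i :: l => Some (flip x (foldr minn i l))
  end.

Definition gk_down (n : nat) (x : vertex n) : option (vertex n) :=
  match unmatched1 x with
  | [::] => None
  | i :: l => Some (flip x (foldr maxn i l))
  end.

(* {x, y} is an edge of some chain of the Greene–Kleitman SCD: consecutive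
   vertices of the chain through x (obtained by one ascending or one
   descending step from x). *)
Definition gk_edge (n : nat) (x y : vertex n) : bool :=
  (gk_up x == Some y) || (gk_down x == Some y).

Definition hamilton_cycle (n : nat) (c : seq (vertex n)) : bool :=
  [&& uniq c, all (fun x => x \in c) (enum [set: vertex n]) & cycle (@qadj n) c].

Definition cycle_edge (n : nat) (c : seq (vertex n)) (x y : vertex n) : bool :=
  [&& x \in c, y \in c & (next c x == y) || (next c y == x)].

(* Main.v *)
Require Import Defs.
From mathcomp Require Import all_boot zify.

Set Implicit Arguments. Unset Strict Implicit. Unset Printing Implicit Defensive.

(* Appending two bits to the vertices of a Greene-Kleitman chain C of Q_n gives at
   most four Greene-Kleitman chains of Q_{n+2}, and C x Q_2 has a Hamilton cycle
   through all of them. Three of its remaining edges, the ports of C, lie over the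
   top vertex of C (one) and over its bottom vertex (two). If the tops, or the
   bottoms, of two chains are adjacent in Q_n, then parallel ports over them span
   a 4-cycle, and exchanging the ports for the other two edges of the 4-cycle joins
   the two Hamilton cycles. So it suffices to link all chains of Q_n to a tree that
   uses every port at most once. Such a tree for Q_n yields one for Q_{n+2}: link
   the chains of a block internally, and replace a link between two chains by a
   link between corresponding chains of their blocks. *)

(** * Cyclic sequences and their edges *)

(* Locked because [inE] would otherwise unfold [pairs] on explicit lists. *)
Fact pairs_key : unit. Proof. by []. Qed.
Definition pairs {T : Type} (s : seq T) := locked_with pairs_key (zip s (behead s)).

Section Cycles.
Variable T : eqType.
Implicit Types (s c : seq T) (e : rel T).

Definition cpairs c := if c is a :: s then pairs (a :: rcons s a) else [::].

Definition edge c u v := ((u, v) \in cpairs c) || ((v, u) \in cpairs c).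

Lemma pairs_cons2 a b s : pairs (a :: b :: s) = (a, b) :: pairs (b :: s).
Proof. by rewrite /pairs !unlock. Qed.

Lemma pairs0 : pairs (Nil T) = [::].
Proof. by rewrite /pairs unlock. Qed.

Lemma pairs1 (a : T) : pairs [:: a] = [::].
Proof. by rewrite /pairs !unlock. Qed.

Lemma pairs_cat a s b t :
  pairs ((a :: s) ++ b :: t) = pairs (a :: s) ++ (last a s, b) :: pairs (b :: t).
Proof.
elim: s a => [|x s IHs] a /=; first by rewrite pairs_cons2 pairs1.
by rewrite !pairs_cons2 (IHs x) cat_cons.
Qed.

Lemma pairs_rcons a s b : pairs (a :: rcons s b) = rcons (pairs (a :: s)) (last a s, b).
Proof. by rewrite -cats1 -cat_cons pairs_cat pairs1 cats1. Qed.

Lemma cpairs_cons a s : cpairs (a :: s) = rcons (pairs (a :: s)) (last a s, a).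
Proof. exact: pairs_rcons. Qed.

Lemma mem_pairs_rev s u v : ((u, v) \in pairs (rev s)) = ((v, u) \in pairs s).
Proof.
elim: s => [|a [|b s] IHs]; rewrite ?pairs0 ?pairs1 //.
rewrite rev_cons pairs_cons2 inE -IHs rev_cons.
case Er: (rcons (rev s) b) => [|x r]; first by case: (rev s) Er.
rewrite rcons_cons pairs_rcons mem_rcons inE.
have -> : last x r = b by have := congr1 (last b) Er; rewrite last_rcons /=.
by rewrite !xpair_eqE andbC.
Qed.

Lemma mem_pairs s u v : (u, v) \in pairs s -> (u \in s) && (v \in s).
Proof.
elim: s => [|a [|b s] IHs]; rewrite ?pairs0 ?pairs1 //.
rewrite pairs_cons2 inE.
case/predU1P => [[-> ->]|/IHs/andP[us vs]]; first by rewrite !inE !eqxx ?orbT.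
by rewrite us in_cons vs !orbT.
Qed.

Lemma mem_cpairs c u v : (u, v) \in cpairs c -> (u \in c) && (v \in c).
Proof.
case: c => // a s /mem_pairs; rewrite -rcons_cons !mem_rcons.
by rewrite in_cons [v \in _]in_cons; do 2 case: eqP => [->|_]; rewrite ?mem_head.
Qed.

Lemma mem_edge c u v : edge c u v -> (u \in c) && (v \in c).
Proof. by case/orP => /mem_cpairs // /andP[-> ->]. Qed.

Lemma edgeC c u v : edge c u v = edge c v u.
Proof. by rewrite /edge orbC. Qed.

Lemma path_pairs e a s : path e a s = all (fun p => e p.1 p.2) (pairs (a :: s)).
Proof.
by elim: s a => [|b s IHs] a; rewrite ?pairs1 //= pairs_cons2 IHs.
Qed.

Lemma cycle_cpairs e c : cycle e c = all (fun p => e p.1 p.2) (cpairs c).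
Proof. by case: c => // a s; rewrite /= path_pairs. Qed.

Lemma cpairs_rot c1 c2 : perm_eq (cpairs (c1 ++ c2)) (cpairs (c2 ++ c1)).
Proof.
case: c1 c2 => [|a s] [|b t]; rewrite ?cats0 //.
rewrite !cat_cons !cpairs_cons -!cat_cons !pairs_cat !last_cat /=.
by apply/permP => p; rewrite -!cats1 ?count_cat /= ?count_cat /=; lia.
Qed.

Lemma mem_cpairs_rev c u v : ((u, v) \in cpairs (rev c)) = ((v, u) \in cpairs c).
Proof.
case: c => // a s.
have -> : cpairs (rev (a :: s)) =i cpairs (a :: rev s).
  by apply: perm_mem; rewrite rev_cons -cats1 (perm_trans (cpairs_rot _ _)).
by rewrite /= -(mem_pairs_rev (a :: rcons s a)) rev_cons rev_rcons.
Qed.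

(** Rotation, after a reversal if the cycle runs from [a] to [b], makes any chosen edge the closing
    one. The rest is then a path from [a] to [b]. *)
Lemma edge_split e c a b : edge c a b -> symmetric e -> cycle e c ->
  exists2 s, last a s = b &
    [/\ perm_eq c (a :: s), cycle e (a :: s) & edge (a :: s) =2 edge c].
Proof.
move=> ab e_sym; wlog ba : c ab / (b, a) \in cpairs c => [wl|].
  case/orP: (ab) => [ba|]; last exact: wl.
  move=> cyc; have E : edge (rev c) =2 edge c.
    by move=> u v; rewrite /edge !mem_cpairs_rev orbC.
  have [| | |s ls [perm_s cyc_s edge_s]] := wl (rev c).
  - by rewrite E.
  - by rewrite mem_cpairs_rev.
  - by rewrite rev_cycle (eq_cycle (e' := e)).
  exists s => //; split => //; first by rewrite -(perm_rev c).
  by move=> u v; rewrite edge_s E.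
move=> cyc; case: c ba {ab} cyc => // x c ba cyc.
move: ba; rewrite cpairs_cons mem_rcons inE => /predU1P[[-> ->]|ba].
  by exists c.
have [c1 [c2 Ec]] : exists c1 c2, x :: c = rcons c1 b ++ a :: c2.
  elim: c x ba {cyc} => [|y c IHc] x; first by rewrite pairs1.
  rewrite pairs_cons2 inE.
  case/predU1P => [[-> ->]|/IHc[c1 [c2 ->]]]; first by exists [::], c.
  by exists (x :: c1), c2.
rewrite {}Ec in cyc *.
exists (c2 ++ rcons c1 b); first by rewrite last_cat last_rcons.
have cyc_perm := cpairs_rot (rcons c1 b) (a :: c2).
split; first by rewrite perm_catC.
- by rewrite -cat_cons cycle_cpairs -(perm_all _ cyc_perm) -cycle_cpairs.
- by move=> u v; rewrite /edge -cat_cons -!(perm_mem cyc_perm).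
Qed.

(** Opening each cycle at its chosen edge leaves a path from [a] to [b] and a path from [b'] to
    [a']. The edges [b b'] and [a' a] close their concatenation to one cycle, so only the two chosen
    edges can be lost. *)
Lemma cycle_merge e c1 c2 a b a' b' : symmetric e -> cycle e c1 -> cycle e c2 ->
    edge c1 a b -> edge c2 a' b' -> e a a' -> e b b' ->
  exists c, [/\ perm_eq c (c1 ++ c2), cycle e c &
    forall u v, edge c1 u v || edge c2 u v ->
      [|| edge c u v, (u, v) \in [:: (a, b); (b, a)]
        | (u, v) \in [:: (a', b'); (b', a')]]].
Proof.
move=> e_sym cyc1 cyc2 ab a'b' aa' bb'.
have [s ls [perm1 {}cyc1 edge1]] := edge_split ab e_sym cyc1.
have := a'b'; rewrite edgeC => b'a'.
have [t lt [perm2 {}cyc2 edge2]] := edge_split b'a' e_sym cyc2.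
exists ((a :: s) ++ b' :: t); split.
- by rewrite perm_sym perm_cat.
- move: cyc1 cyc2; rewrite !cycle_cpairs cat_cons !cpairs_cons -cat_cons pairs_cat.
  rewrite last_cat /= ls lt !all_rcons all_cat /=.
  by case/andP => _ -> /andP[_ ->]; rewrite bb' e_sym aa'.
move=> u v; rewrite -edge1 -edge2 /edge cat_cons !cpairs_cons -cat_cons pairs_cat.
rewrite last_cat /= ls lt !mem_rcons !inE !mem_cat !inE !xpair_eqE.
case: (_ \in pairs (a :: s)); rewrite ?orbT //.
case: (_ \in pairs (a :: s)); rewrite ?orbT //.
case: (_ \in pairs (b' :: t)); rewrite ?orbT //.
case: (_ \in pairs (b' :: t)); rewrite ?orbT // !orbF.
by case/orP => /orP[] /andP[-> ->]; rewrite ?orbT.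
Qed.

Lemma next_cpairs c u v : uniq c -> (u, v) \in cpairs c -> next c u = v.
Proof.
case: c => // a s uniq_c uv; have /andP[u_c _] := mem_cpairs uv.
have E x : pairs (x :: rcons s a) = zip (x :: s) (rcons s a).
  elim: (s) x => [|y r IHr] x /=; first by rewrite pairs_cons2 pairs1.
  by rewrite pairs_cons2 IHr.
have /(nthP (a, a))[i lti] := uv; rewrite /cpairs E in lti *.
have sz : size (a :: s) = size (rcons s a) by rewrite size_rcons.
rewrite nth_zip // => -[ui vi]; rewrite next_nth u_c.
rewrite size_zip -sz minnn in lti.
(* At [i = size s] the default value of [nth] in [next_nth] is the first vertex [a], which is
   exactly the wrap-around. *)
rewrite -{1}ui index_uniq // -vi nth_rcons; case: ltngtP => // si.
  by move: lti => /=; lia.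
by rewrite si nth_default.
Qed.
Lemma pairs_cat_default (x : T) s t : s != [::] -> t != [::] ->
  pairs (s ++ t) = pairs s ++ (last x s, head x t) :: pairs t.
Proof. by case: s t => [|a s] [|b t] // _ _; rewrite pairs_cat. Qed.

Lemma head_rev (x : T) s : head x (rev s) = last x s.
Proof. by case/lastP: s => // s y; rewrite rev_rcons last_rcons. Qed.

Lemma last_rev (x : T) s : last x (rev s) = head x s.
Proof. by rewrite -head_rev revK. Qed.

Lemma rev_eq0 (s : seq T) : (rev s == [::]) = (s == [::]).
Proof. by rewrite -!size_eq0 size_rev. Qed.
End Cycles.

Lemma pairs_map (T T' : eqType) (f : T -> T') s :
  pairs (map f s) = map (fun p => (f p.1, f p.2)) (pairs s).
Proof.
elim: s => [|a [|b s] IHs]; rewrite ?pairs0 ?pairs1 //.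
by rewrite /= !pairs_cons2 /= -IHs.
Qed.

(** * Greene-Kleitman chains *)

(** Plain bit lists replace tuples until the very end, so that appending a bit needs no casts;
    [val_flip] makes the connection with [flip]. *)
Fixpoint flips (x : seq bool) (j : nat) : seq bool :=
  match x, j with
  | [::], _ => [::]
  | b :: x', 0 => ~~ b :: x'
  | b :: x', j'.+1 => b :: flips x' j'
  end.

Lemma size_flips x j : size (flips x j) = size x.
Proof. by elim: x j => [|b x IHx] [|j] //=; rewrite IHx. Qed.

Lemma flipsK x j : flips (flips x j) j = x.
Proof. by elim: x j => [|b x IHx] [|j] //=; rewrite ?negbK ?IHx. Qed.

Lemma flips_rcons x b j : j < size x -> flips (rcons x b) j = rcons (flips x j) b.
Proof. by elim: x j => [|a x IHx] [|j] //= ltj; rewrite IHx. Qed.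

Lemma flips_rcons_size x b : flips (rcons x b) (size x) = rcons x (~~ b).
Proof. by elim: x => //= a x ->. Qed.

Lemma nth_flips x i j : i < size x ->
  nth false (flips x j) i = if i == j then ~~ nth false x i else nth false x i.
Proof. by elim: x i j => [|a x IHx] [|i] [|j] //= lti; rewrite IHx. Qed.

Definition hadj (x y : seq bool) := has (fun j => y == flips x j) (iota 0 (size x)).

Lemma hadjP x y : reflect (exists2 j, j < size x & y = flips x j) (hadj x y).
Proof.
apply: (iffP hasP) => [[j] | [j ltj ->]].
  by rewrite mem_iota => ltj /eqP ->; exists j.
by exists j; rewrite ?mem_iota.
Qed.

Lemma hadj_sym : symmetric hadj.
Proof.
by move=> x y; apply/hadjP/hadjP => -[j ltj ->]; exists j; rewrite ?size_flips ?flipsK.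
Qed.

Lemma hadj_rcons b x y : hadj x y -> hadj (rcons x b) (rcons y b).
Proof.
case/hadjP => j ltj ->; apply/hadjP; exists j; rewrite ?flips_rcons //.
by rewrite size_rcons ltnW.
Qed.

Lemma hadj_last x b : hadj (rcons x b) (rcons x (~~ b)).
Proof. by apply/hadjP; exists (size x); rewrite ?flips_rcons_size ?size_rcons. Qed.

(* A chain is the list of its vertices from top to bottom. Appending one bit to
   the vertices of a chain [C] of Q_n gives two chains of Q_{n+1}: in [chain0 C]
   the new position is unmatched, in [chain1 C] it is matched to the rightmost
   unmatched position of [C]. *)
Definition chain0 (C : seq (seq bool)) :=
  if C is l :: _ then rcons l true :: map (rcons^~ false) C else [::].

Definition chain1 (C : seq (seq bool)) := map (rcons^~ true) (behead C).

(** A one-vertex chain has no unmatched position that a new 1 could be matched to, so its [chain1]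
    is empty and gets dropped. *)
Definition split_chain C := [seq X <- [:: chain0 C; chain1 C] | X != [::]].

Fixpoint gk_chains (n : nat) : seq (seq (seq bool)) :=
  if n is n'.+1 then flatten (map split_chain (gk_chains n')) else [:: [:: [::]]].

Definition append_bit (X : seq (seq bool)) :=
  map (rcons^~ false) X ++ map (rcons^~ true) X.

Lemma append_bit_cat X Y :
  perm_eq (append_bit (X ++ Y)) (append_bit X ++ append_bit Y).
Proof. by apply/permP => p; rewrite /append_bit !map_cat !count_cat; lia. Qed.

Lemma perm_append_bit X Y : perm_eq X Y -> perm_eq (append_bit X) (append_bit Y).
Proof. by move=> XY; rewrite perm_cat ?perm_map. Qed.

Lemma mem_append_bit x b X : (rcons x b \in append_bit X) = (x \in X).
Proof.
have inj c : injective (rcons^~ c : seq bool -> _) by move=> y z /rcons_inj[].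
rewrite mem_cat; case: b; last first.
  by rewrite (mem_map (inj false)) orbC; case: mapP => // -[y _ /rcons_inj[]].
by rewrite (mem_map (inj true)); case: mapP => // -[y _ /rcons_inj[]].
Qed.

Lemma flatten_split_chain C : perm_eq (flatten (split_chain C)) (append_bit C).
Proof.
case: C => [|l [|l' R]] //; apply/permP => p;
  rewrite /split_chain /append_bit /= ?cats0 ?count_cat /= ?count_cat /=; lia.
Qed.

Lemma flatten_gk_chainsS n :
  perm_eq (flatten (gk_chains n.+1)) (append_bit (flatten (gk_chains n))).
Proof.
rewrite /=; elim: (gk_chains n) => //= C Cs IHC.
rewrite flatten_cat perm_sym (permPl (append_bit_cat _ _)).
by rewrite perm_cat // perm_sym ?flatten_split_chain.
Qed.

Lemma gk_chains_uniq n : uniq (flatten (gk_chains n)).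
Proof.
elim: n => // n IHn; rewrite (perm_uniq (flatten_gk_chainsS n)) cat_uniq.
rewrite !map_inj_uniq ?IHn /=; try by move=> x y /rcons_inj[].
rewrite andbT; apply/hasPn => _ /mapP[x _ ->]; apply/mapP => -[y _] /rcons_inj[].
by [].
Qed.

Lemma mem_gk_chains n x : (x \in flatten (gk_chains n)) = (size x == n).
Proof.
elim: n x => [|n IHn] x; first by case: x.
rewrite (perm_mem (flatten_gk_chainsS n)).
case/lastP: x => [|x b]; last by rewrite mem_append_bit size_rcons eqSS.
by rewrite mem_cat; apply/negP => /orP[] /mapP[[]].
Qed.

(** The scan runs from left to right, so a bit appended on the right affects only the top of the
    final stack, the rightmost unmatched 0. *)
Lemma bscan_rcons s b i st : bscan (rcons s b) i st =
  let r := bscan s i st in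
  if b then (if r.1 is _ :: a then (a, r.2) else ([::], rcons r.2 (i + size s)))
  else (i + size s :: r.1, r.2).
Proof.
elim: s i st => [|[] s IHs] i st /=; rewrite ?addn0.
- by case: (b); case: st.
- by case: st => [|j st]; rewrite IHs addnS //=; case: (b); case: (bscan _ _ _).1.
- by rewrite IHs addnS.
Qed.

(* [a] and [b] list the unmatched 0s and 1s of the top vertex of [C] from right
   to left, so that [a ++ b] does not change along the chain. *)
Fixpoint gk_chain (C : seq (seq bool)) (a b : seq nat) : Prop :=
  if C is x :: R then
    bscan x 0 [::] = (a, rev b) /\
    match R, b with
    | [::], [::] => True
    | y :: _, j :: b' => y = flips x j /\ gk_chain R (rcons a j) b'
    | _, _ => False
    end
  else False.

(** The empty list of unmatched 0s makes the first vertex a top, and the decreasing order of [b]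
    makes every step down flip the rightmost unmatched 1. *)
Definition greene_kleitman n C := exists b,
  [/\ gk_chain C [::] b, sorted gtn b, all (gtn n) b & all (fun x => size x == n) C].

Lemma gk_chain_rcons0 n C a b :
    all (gtn n) b -> all (fun x => size x == n) C ->
  gk_chain C a b -> gk_chain (map (rcons^~ false) C) (n :: a) b.
Proof.
elim: C a b => //= x R IHR a b b_lt /andP[/eqP szx szR] [scan_x step].
rewrite bscan_rcons scan_x szx; split => //.
case: R IHR szR step => [|y R] //= IHR szR.
case: b b_lt scan_x => //= j b /andP[ltj ltb] _ [Ey step].
by split; [rewrite flips_rcons ?szx ?Ey | apply: (IHR (rcons a j) b)].
Qed.

(** The appended 1 pops [j]. This is the same [j] at every vertex of the chain, because flipped
    positions join the unmatched 0s at the other end of the list. *)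
Lemma gk_chain_rcons1 n C j a b :
    all (gtn n) b -> all (fun x => size x == n) C ->
  gk_chain C (j :: a) b -> gk_chain (map (rcons^~ true) C) a b.
Proof.
elim: C a b => //= x R IHR a b b_lt /andP[/eqP szx szR] [scan_x step].
rewrite bscan_rcons scan_x szx; split => //.
case: R IHR szR step => [|y R] //= IHR szR.
case: b b_lt scan_x => //= i b /andP[lti ltb] _ [Ey step].
by split; [rewrite flips_rcons ?szx ?Ey | apply: (IHR (rcons a i) b)].
Qed.

Lemma gk_chains_greene_kleitman n C : C \in gk_chains n -> greene_kleitman n C.
Proof.
elim: n C => [|n IHn] C.
  by rewrite inE => /eqP ->; exists [::].
case/flatten_mapP => C0 /IHn[b [gkC b_sort b_lt sz]].
have sz_rcons (c : bool) D : all (fun x => size x == n) D ->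
    all (fun x => size x == n.+1) (map (rcons^~ c) D).
  by rewrite all_map; apply: sub_all => x /=; rewrite size_rcons.
have b_ltS d : all (gtn n) d -> all (gtn n.+1) d.
  by apply: sub_all => i /=; lia.
rewrite mem_filter !inE => /andP[C_n0 /orP[]/eqP EC]; rewrite {}EC in C_n0 *;
  case: C0 C_n0 gkC sz => // l R C_n0 gkC sz.
  (* For [chain0], the 1 appended to the old top is the rightmost unmatched 1 of the new top. *)
  exists (n :: b); split=> /=.
  - have [scan_l _] := gkC; have /andP[/eqP szl _] := sz.
    rewrite bscan_rcons scan_l /= szl rev_cons; split=> //; split.
      by rewrite -szl flips_rcons_size.
    exact: gk_chain_rcons0 b_lt sz gkC.
  - by case: b b_sort b_lt {gkC} => //= j b -> /andP[-> _].
  - by rewrite ltnSn b_ltS.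
  - by move: (sz_rcons false _ sz) (sz_rcons true _ sz) => /= -> /andP[-> _].
(* [chain1] begins over the second vertex of the old chain, whose only unmatched 0 is the position
   [j] just flipped; the appended 1 is matched to it, and [b] loses its head. *)
case: R b gkC sz b_sort b_lt C_n0 => [|y R] [|j b] //=; try by case.
move=> [_ [_ gkR]] /andP[_ szR] b_sort /andP[_ b_lt] _; exists b; split.
- exact: (gk_chain_rcons1 (C := y :: R) (a := [::]) b_lt szR gkR).
- exact: path_sorted b_sort.
- exact: b_ltS.
- exact: (sz_rcons true (y :: R)).
Qed.

Lemma greene_kleitman_sorted n C : greene_kleitman n C -> sorted hadj C.
Proof.
case=> b [gkC _ b_lt sz].
elim: C [::] b gkC b_lt sz => //= x [|y R] IHR a [|j b] //=; first by move=> [_ []].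
move=> [_ [Ey gkR]] /andP[ltj b_lt] /andP[/eqP szx sz]; subst y.
apply/andP; split; first by apply/hadjP; exists j; rewrite ?szx.
exact: IHR gkR b_lt sz.
Qed.

(** * Chain steps as steps of [gk_up] and [gk_down] *)

Lemma foldr_minn j i l : j \in i :: l -> all (leq j) (i :: l) -> foldr minn i l = j.
Proof.
elim: l i => [|k l IHl] i; first by rewrite inE => /eqP ->.
move=> /= j_in /and3P[ji jk jl].
have ge_j : j <= foldr minn i l by elim: (l) jl => //= m r IH /andP[jm /IH]; lia.
have [Ej|nj] := eqVneq j k; first by rewrite Ej in ge_j *; lia.
by rewrite (IHl i) /= ?ji //; [lia | move: j_in; rewrite !inE (negPf nj)].
Qed.

Lemma foldr_maxn j i l : j \in i :: l -> all (geq j) (i :: l) -> foldr maxn i l = j.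
Proof.
elim: l i => [|k l IHl] i; first by rewrite inE => /eqP ->.
move=> /= j_in /and3P[ji jk jl].
have le_j : foldr maxn i l <= j by elim: (l) jl => //= m r IH /andP[jm /IH]; lia.
have [Ej|nj] := eqVneq j k; first by rewrite Ej in le_j *; lia.
by rewrite (IHl i) /= ?ji //; [lia | move: j_in; rewrite !inE (negPf nj)].
Qed.

(** The position flipped to reach [x] from above comes last in [a]. Since [a ++ b] is decreasing and
    constant along the chain, this position is the leftmost unmatched 0, and flipping it leads back
    up. *)
Lemma greene_kleitman_up n C x i l : greene_kleitman n C -> x \in C ->
  (bscan x 0 [::]).1 = i :: l -> (flips x (foldr minn i l), x) \in pairs C.
Proof.
case=> b [gkC b_sort _ _] x_C scan_x.
(* The induction passes to tails of the chain, whose first vertex has its upper neighbour outside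
   the tail. For the whole chain this alternative fails, since the top has no unmatched 0. *)
have: x = head [::] C \/ (flips x (foldr minn i l), x) \in pairs C.
  move: b_sort; rewrite -[b]/([::] ++ b).
  elim: C [::] b gkC x_C => //= y [|z R] IHR a b.
    by rewrite inE => _ /eqP; left.
  case: b => [[]|j b [_ [Ez gkR]]] //; subst z.
  rewrite inE => /predU1P[|x_R sab]; first by left.
  right; rewrite pairs_cons2 inE.
  have [|Ex|->] := IHR _ _ gkR x_R; rewrite ?orbT ?cat_rcons //.
  rewrite /= in Ex; case: gkR => scan _.
  have Ea : i :: l = rcons a j by rewrite -scan_x Ex scan.
  apply/orP; left; rewrite xpair_eqE Ex eqxx andbT (foldr_minn (j := j)) ?flipsK //.
    by rewrite Ea mem_rcons mem_head.
  rewrite Ea all_rcons leqnn /=.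
  move: sab; rewrite sorted_pairwise; last by move=> p q r /=; lia.
  rewrite pairwise_cat => /and3P[/allrelP aj _ _].
  by apply/allP => k /aj /(_ (mem_head _ _)) /=; lia.
case=> // Ex; case: C gkC x_C Ex => //= y R [scan _] _ Ex.
by rewrite Ex scan in scan_x.
Qed.

Lemma greene_kleitman_down n C x i l : greene_kleitman n C -> x \in C ->
  (bscan x 0 [::]).2 = i :: l -> (x, flips x (foldr maxn i l)) \in pairs C.
Proof.
case=> b [gkC b_sort _ _] x_C scan_x.
elim: C [::] b gkC b_sort x_C => //= y R IHR a b [scan step] b_sort.
rewrite inE => /predU1P[Ex|x_R]; last first.
  case: R b IHR scan step b_sort x_R => [|z R] [|j b] //= IHR _ [Ez gkR] b_sort x_R.
  by subst z; rewrite pairs_cons2 inE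
     (IHR _ _ gkR) ?orbT // (path_sorted b_sort).
rewrite Ex scan /= in scan_x *.
case: b {IHR} scan step b_sort scan_x => //= j b _ step b_sort Erev.
case: R step => [|z R] //= [-> _].
rewrite pairs_cons2 inE xpair_eqE eqxx /=.
rewrite (foldr_maxn (j := j)) ?eqxx // -Erev ?mem_rev ?mem_head // all_rev /= leqnn /=.
move: b_sort; rewrite path_sortedE => [/andP[+ _]|p q r /=]; last by lia.
by apply: sub_all => k /=; lia.
Qed.

(** * Blocks and ports *)

Definition rcons2 (a b : bool) (x : seq bool) := rcons (rcons x a) b.

Lemma rcons2_eq a b x a' b' x' :
  (rcons2 a b x == rcons2 a' b' x') = [&& x == x', a == a' & b == b'].
Proof. by rewrite /rcons2 !eqseq_rcons andbA. Qed.

Lemma hadj_rcons2 a b x y : hadj x y -> hadj (rcons2 a b x) (rcons2 a b y).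
Proof. by move=> xy; do 2 apply: hadj_rcons. Qed.

Lemma hadj_rcons2l a b x : hadj (rcons2 a b x) (rcons2 (~~ a) b x).
Proof. exact/hadj_rcons/hadj_last. Qed.

Lemma hadj_rcons2r a b x : hadj (rcons2 a b x) (rcons2 a (~~ b) x).
Proof. exact: hadj_last. Qed.

Lemma mem_rcons2 a b x X : (rcons2 a b x \in append_bit (append_bit X)) = (x \in X).
Proof. by rewrite !mem_append_bit. Qed.

(* A Hamilton cycle of C x Q_2 that runs through all chains obtained from [C] by
   appending two bits. *)
Definition block_cycle (C : seq (seq bool)) :=
  if C is l :: R then
    rcons2 true false l :: rcons2 true true l :: map (rcons2 false true) C ++
    rev (map (rcons2 true true) R) ++ map (rcons2 true false) R ++
    rev (map (rcons2 false false) C)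
  else [::].

(** The pieces with constant appended bits are joined by six edges: three over the top [l], one over
    [l'] and two over the bottom [y]. Three of the six lie on chains; the others are the ports,
    namely [11]-[01] over [l] and both edges over [y]. *)
Lemma cpairs_block_cycle l l' R (C := [:: l, l' & R]) (y := last l' R) :
  cpairs (block_cycle C) =
    (rcons2 true false l, rcons2 true true l) ::
    (rcons2 true true l, rcons2 false true l) ::
    pairs (map (rcons2 false true) C) ++
    (rcons2 false true y, rcons2 true true y) ::
    pairs (rev (map (rcons2 true true) (l' :: R))) ++
    (rcons2 true true l', rcons2 true false l') ::
    pairs (map (rcons2 true false) (l' :: R)) ++
    (rcons2 true false y, rcons2 false false y) ::
    pairs (rev (map (rcons2 false false) C)) ++
    [:: (rcons2 false false l, rcons2 true false l)].
Proof.
rewrite {}/C; set C := [:: l, l' & R].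
have nX : map (rcons2 false true) C != [::] by [].
have nY : rev (map (rcons2 true true) (l' :: R)) != [::] by rewrite rev_eq0.
have nZ : map (rcons2 true false) (l' :: R) != [::] by [].
have nW : rev (map (rcons2 false false) C) != [::] by rewrite rev_eq0.
have EX t : pairs [:: rcons2 true false l, rcons2 true true l &
      map (rcons2 false true) C ++ t]
  = [:: (rcons2 true false l, rcons2 true true l), (rcons2 true true l, rcons2 false true l)
     & pairs (map (rcons2 false true) C ++ t)].
  by rewrite /C !map_cons !cat_cons !pairs_cons2.
have head_cat s t : s != [::] -> head [::] (s ++ t) = head [::] s :> seq bool by case: s.
have cat_n0 s t : s != [::] -> s ++ t != [::] :> seq (seq bool) by case: s.
rewrite /block_cycle cpairs_cons EX !(pairs_cat_default [::]) ?cat_n0 //.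
rewrite !head_cat // !head_rev /= !last_cat !last_rev /= !last_map.
by rewrite -cats1 /= -!catA /= -!catA /= !last_cat last_rev -!catA.
Qed.

(* [chain_ab C] is named after the bits appended to its bottom vertex. *)
Definition chain00 C := chain0 (chain0 C).
Definition chain01 C := chain1 (chain0 C).
Definition chain10 C := chain0 (chain1 C).
Definition chain11 C := chain1 (chain1 C).

Lemma chain00E l R : chain00 (l :: R) =
  [:: rcons2 true true l, rcons2 true false l & map (rcons2 false false) (l :: R)].
Proof. by rewrite /chain00 /= -map_comp. Qed.

Lemma chain01E C : chain01 C = map (rcons2 false true) C.
Proof. by case: C => // l R; rewrite /chain01 /= /chain1 /= -map_comp. Qed.

Lemma chain10E l l' R : chain10 [:: l, l' & R] =
  rcons2 true true l' :: map (rcons2 true false) (l' :: R).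
Proof. by rewrite /chain10 /= -map_comp. Qed.

Lemma chain11E l l' R : chain11 [:: l, l' & R] = map (rcons2 true true) R.
Proof. by rewrite /chain11 /chain1 /= -map_comp. Qed.

Definition block C := flatten (map split_chain (split_chain C)).

Lemma block1 l : block [:: l] = [:: chain00 [:: l]; chain01 [:: l]].
Proof. by []. Qed.

Lemma block2 C : 1 < size C ->
  block C = [:: chain00 C; chain01 C; chain10 C] ++ [seq X <- [:: chain11 C] | X != [::]].
Proof. by case: C => [|l [|l' [|l'' R]]]. Qed.

Lemma append_bit2 X : append_bit (append_bit X) =
  map (rcons2 false false) X ++ map (rcons2 true false) X ++
  map (rcons2 false true) X ++ map (rcons2 true true) X.
Proof. by rewrite /append_bit !map_cat -!map_comp -catA. Qed.

Lemma perm_block_cycle C : perm_eq (block_cycle C) (append_bit (append_bit C)).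
Proof.
case: C => // l R; rewrite append_bit2; apply/permP => p.
by rewrite /= ?(count_cat, count_rev) /= ?(count_cat, count_rev) /= count_cat /=; lia.
Qed.

Lemma block_cycle_hadj C : sorted hadj C -> cycle hadj (block_cycle C).
Proof.
case: C => [|l [|l' R]] // sorted_C.
  by rewrite /= !hadj_rcons2l !hadj_rcons2r.
have map_hadj a b D u v : sorted hadj D ->
    (u, v) \in pairs (map (rcons2 a b) D) -> hadj u v.
  rewrite pairs_map; case: D => [|x D] /=; first by rewrite pairs0.
  rewrite path_pairs => /allP D_hadj.
  case/mapP => -[u' v'] /D_hadj /= uv [-> ->].
  exact: hadj_rcons2.
have sorted_R : sorted hadj (l' :: R) by apply: path_sorted sorted_C.
rewrite cycle_cpairs cpairs_block_cycle; apply/allP => -[u v] /=.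
rewrite !(inE, mem_cat) !mem_pairs_rev.
repeat case/orP; try by move=> /eqP[-> ->]; rewrite ?hadj_rcons2l ?hadj_rcons2r.
- exact: (map_hadj false true _ _ _ sorted_C).
- rewrite hadj_sym; exact: (map_hadj true true _ _ _ sorted_R).
- exact: (map_hadj true false _ _ _ sorted_R).
- rewrite hadj_sym; exact: (map_hadj false false _ _ _ sorted_C).
Qed.

Lemma block_edge C X u v : X \in block C -> (u, v) \in pairs X -> edge (block_cycle C) u v.
Proof.
case: C => [|l [|l' R]] //.
  rewrite block1 chain00E chain01E !inE => /orP[]/eqP->; rewrite ?pairs1 //.
  by rewrite !pairs_cons2 pairs1 !inE => /orP[]/eqP[-> ->];
    rewrite /edge /= !pairs_cons2 !inE !eqxx ?orbT.
rewrite block2 // /edge cpairs_block_cycle !(inE, mem_cat, mem_pairs_rev) mem_filter inE.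
rewrite chain00E chain01E chain10E chain11E.
case/or4P => [/eqP->|/eqP->|/eqP->|/andP[_ /eqP->]].
- rewrite !pairs_cons2 !inE => /or3P[/eqP[-> ->]|/eqP[-> ->]|->]; by rewrite ?eqxx ?orbT.
- by move=> ->; rewrite ?orbT.
- by rewrite pairs_cons2 inE => /orP[/eqP[-> ->]|->]; rewrite ?eqxx ?orbT.
case: R => [|x R] uv; first by rewrite pairs0 in uv.
(* [chain11] covers [R] only, but the cycle traverses the whole copy of [l' :: R]. *)
have uv' : (u, v) \in pairs (map (rcons2 true true) [:: l', x & R]).
  by rewrite pairs_cons2 inE uv orbT.
by rewrite uv' ?orbT.
Qed.

(* The edges of [block_cycle C] outside the chains that can be exchanged: [None]
   stands for the edge over the top vertex, the other two lie over the bottom. *)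
Definition port_vertex (p : option bool) (C : seq (seq bool)) :=
  if p is None then head [::] C else last [::] C.

Definition port_fst (p : option bool) :=
  if p == Some false then rcons2 false false else rcons2 true true.

Definition port_snd (p : option bool) :=
  if p == Some false then rcons2 true false else rcons2 false true.

Definition port_ends p C :=
  [:: (port_fst p (port_vertex p C), port_snd p (port_vertex p C));
      (port_snd p (port_vertex p C), port_fst p (port_vertex p C))].

Lemma mem_port_vertex p C : C != [::] -> port_vertex p C \in C.
Proof. by case: C p => // l R [p|] _; rewrite /= ?mem_last ?mem_head. Qed.

Lemma port_edge p C : C != [::] -> (p != None -> 1 < size C) ->
  edge (block_cycle C) (port_fst p (port_vertex p C)) (port_snd p (port_vertex p C)).
Proof.
case: C => [|l [|l' R]] //.
  by case: p => [p _ /(_ isT)|_ _]; rewrite // /edge /= !pairs_cons2 !inE !eqxx ?orbT.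
rewrite /edge cpairs_block_cycle !(inE, mem_cat) => _ _.
by case: p => [[]|]; rewrite /= !eqxx ?orbT.
Qed.

Lemma head_neq_last (C : seq (seq bool)) : uniq C -> 1 < size C ->
  (head [::] C == last [::] C) = false.
Proof.
case: C => [|l [|l' R]] //= /andP[l_R _] _; apply: contraNF l_R => /eqP ->.
exact: mem_last.
Qed.

(** [None] and [Some true] carry the same appended bits, so they are told apart by top and bottom
    being different. *)
Lemma port_ends_inj p p' C : uniq C -> 1 < size C ->
  (port_fst p (port_vertex p C), port_snd p (port_vertex p C)) \in port_ends p' C ->
  p = p'.
Proof.
move=> C_uniq C_gt1; have HL := head_neq_last C_uniq C_gt1.
rewrite !inE !xpair_eqE /port_fst /port_snd.
by case: p p' => [[]|] [[]|]; rewrite //= !rcons2_eq ?HL ?[last _ _ == _]eq_sym ?HL ?andbF.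
Qed.

Lemma chain_not_port C X u v p : uniq C -> X \in block C -> (u, v) \in pairs X ->
  (p != None -> 1 < size C) -> (u, v) \notin port_ends p C.
Proof.
move=> C_uniq X_C uv p_gt1.
have same_bits a b D : (u, v) \in pairs (map (rcons2 a b) D) ->
    (u, v) \notin port_ends p C.
  rewrite pairs_map => /mapP[[x y] _ [-> ->]].
  rewrite !inE !xpair_eqE /port_fst /port_snd.
  by case: ifP => _; rewrite !rcons2_eq; case: a; case: b; rewrite ?andbF.
have last_bit a b x y : u = rcons2 a b x -> v = rcons2 a (~~ b) y ->
    (u, v) \notin port_ends p C.
  move=> -> ->; rewrite !inE !xpair_eqE /port_fst /port_snd.
  by case: ifP => _; rewrite !rcons2_eq; case: a; case: b; rewrite ?andbF.
have chain00_not l R : C = l :: R -> X = chain00 C -> (u, v) \notin port_ends p C.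
  move=> EC EX; have : (u, v) \in pairs (chain00 (l :: R)) by rewrite -EC -EX.
  rewrite chain00E !pairs_cons2 inE [in X in _ || X]inE.
  case/or3P => [/eqP[Eu Ev]|/eqP[Eu Ev]|uv_R]; last exact: (same_bits false false (l :: R)).
    exact: last_bit Eu Ev.
  have El : l = head [::] C by rewrite EC.
  rewrite !inE !xpair_eqE Eu Ev El /port_fst /port_snd.
  case: ifP => [/eqP Ep|_]; rewrite !rcons2_eq ?andbF //=.
  by rewrite Ep /= in p_gt1 *; rewrite head_neq_last ?andbF ?p_gt1.
case: C X_C C_uniq p_gt1 same_bits last_bit chain00_not => // l [|l' R] X_C _ _.
  move=> same_bits _ chain00_not.
  rewrite block1 !inE in X_C; case/orP: X_C => /eqP EX.
    exact: (chain00_not _ _ erefl EX).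
  by apply: (same_bits false true [:: l]); rewrite -chain01E -EX.
move=> same_bits last_bit chain00_not.
rewrite block2 // mem_cat mem_filter !inE in X_C.
case/orP: X_C => [/or3P[]/eqP EX|/andP[_ /eqP EX]].
- exact: (chain00_not _ _ erefl EX).
- by apply: (same_bits false true [:: l, l' & R]); rewrite -chain01E -EX.
- rewrite EX chain10E pairs_cons2 inE in uv; case/orP: uv => [/eqP[Eu Ev]|uv].
    exact: last_bit Eu Ev.
  exact: (same_bits true false (l' :: R) uv).
- by apply: (same_bits true true R); rewrite -(chain11E l l') -EX.
Qed.

(** * Trees of chains *)

Lemma same_chain (Cs : seq (seq (seq bool))) C D x : uniq (flatten Cs) ->
  C \in Cs -> D \in Cs -> x \in C -> x \in D -> C = D.
Proof.
elim: Cs => //= E Cs IHCs; rewrite cat_uniq => /and3P[_ /hasPn disj uniq_Cs].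
rewrite !inE => /predU1P[->|C_in] /predU1P[->|D_in] // xC xD; last exact: IHCs.
  by have /disj : x \in flatten Cs; [apply/flattenP; exists D | rewrite xC].
by have /disj : x \in flatten Cs; [apply/flattenP; exists C | rewrite xD].
Qed.

(* [chain_tree Cs us]: the chains [Cs] are linked to a tree, in which a link at
   port [p] joins chains whose [p]-vertices are adjacent, and every port is used
   at most once; [us] lists the used ports, with a chain given by its bottom. *)
Inductive chain_tree :
    seq (seq (seq bool)) -> seq (seq bool * option bool) -> Prop :=
| ChainTree1 C of C != [::] : chain_tree [:: C] [::]
| ChainTreeS Cs us C D p of chain_tree Cs us & C != [::] & D \in Cs & 1 < size D
    & (p != None -> 1 < size C) & (last [::] D, p) \notin us
    & hadj (port_vertex p C) (port_vertex p D) :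
  chain_tree (C :: Cs) [:: (last [::] C, p), (last [::] D, p) & us].

Lemma chain_tree_cycle Cs us : chain_tree Cs us -> uniq (flatten Cs) ->
    {in Cs, forall C, sorted hadj C} ->
  exists c, [/\ perm_eq c (append_bit (append_bit (flatten Cs))), cycle hadj c &
    forall C X u v, C \in Cs -> X \in block C -> (u, v) \in pairs X -> edge c u v].
Proof.
move=> tree_Cs uniq_Cs sorted_Cs.
(* Invariant for the induction: an edge of a block cycle survives unless it is a used port. Since
   ports are not chain edges, this suffices. *)
suff [c [perm_c cycle_c edge_c]] : exists c,
    [/\ perm_eq c (append_bit (append_bit (flatten Cs))), cycle hadj c &
    forall C u v, C \in Cs -> edge (block_cycle C) u v -> edge c u v \/
      exists p, [/\ (last [::] C, p) \in us, p != None -> 1 < size C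
                  & (u, v) \in port_ends p C]].
  exists c; split=> // C X u v C_in X_in uv.
  have [//|[p [_ p_gt1 uv_p]]] := edge_c C u v C_in (block_edge X_in uv).
  have C_uniq : uniq C.
    case/splitPr: C_in uniq_Cs => Cs1 Cs2; rewrite flatten_cat /= !cat_uniq.
    by case/and3P => _ _ /and3P[].
  by have := chain_not_port C_uniq X_in uv p_gt1; rewrite uv_p.
elim: tree_Cs uniq_Cs sorted_Cs => {Cs us}
  [C C_n0 _|Cs us C D p tree_Cs IHCs C_n0 D_in D_gt1 p_gt1 p_free p_adj uniq_CCs] sorted_Cs.
  exists (block_cycle C); split.
  - by rewrite /= cats0 perm_block_cycle.
  - by rewrite block_cycle_hadj ?sorted_Cs ?mem_head.
  - by move=> E u v; rewrite inE => /eqP ->; left.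
have uniq_Cs : uniq (flatten Cs) by move: uniq_CCs; rewrite /= cat_uniq => /and3P[].
have [|c [perm_c cycle_c edge_c]] := IHCs uniq_Cs.
  by move=> E E_in; rewrite sorted_Cs // inE E_in orbT.
have D_n0 : D != [::] by case: (D) D_gt1.
have D_uniq : uniq D.
  case/splitPr: D_in uniq_Cs => Cs1 Cs2; rewrite flatten_cat /= !cat_uniq.
  by case/and3P => _ _ /and3P[].
(* Had this edge been lost, it would be the edge of a used port of [D], and [port_ends_inj] would
   identify that port with the free port [p]. *)
have edge_D : edge c (port_fst p (port_vertex p D)) (port_snd p (port_vertex p D)).
  have [|//|[p' [p'_used _ ends]]] := edge_c D _ _ D_in (port_edge D_n0 (p := p) _) => //.
  by rewrite (port_ends_inj D_uniq D_gt1 ends) p'_used in p_free.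
have edge_C := port_edge C_n0 p_gt1.
have cycle_C : cycle hadj (block_cycle C) by rewrite block_cycle_hadj ?sorted_Cs ?mem_head.
have [||c' [perm_c' cycle_c' edge_c']] :=
  cycle_merge hadj_sym cycle_C cycle_c edge_C edge_D.
- by rewrite /port_fst; case: ifP => _; apply: hadj_rcons2.
- by rewrite /port_snd; case: ifP => _; apply: hadj_rcons2.
exists c'; split=> //.
  rewrite (permPl perm_c') perm_sym /= (permPl (perm_append_bit (append_bit_cat _ _))).
  by rewrite (permPl (append_bit_cat _ _)) perm_cat // perm_sym ?perm_block_cycle.
(* A port edge lies over a vertex of exactly one chain, so a lost edge of a block cycle is charged
   to a port of the same chain. *)
have ends_same E F u v : E \in C :: Cs -> F \in C :: Cs -> F != [::] ->
    edge (block_cycle E) u v -> (u, v) \in port_ends p F -> E = F.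
  move=> E_in F_in F_n0 /mem_edge/andP[+ _] uv_F.
  rewrite (perm_mem (perm_block_cycle E)) => u_E.
  apply: (same_chain uniq_CCs E_in F_in _ (mem_port_vertex p F_n0)).
  move: uv_F u_E; rewrite !inE => /orP[]/eqP[-> _];
    by rewrite /port_fst /port_snd; case: ifP => _; rewrite mem_rcons2.
move=> E u v E_in uv_E.
have [uv|[p' [p'_used p'_gt1 uv_p']]] :
    edge (block_cycle C) u v || edge c u v \/
    exists p, [/\ (last [::] E, p) \in us, p != None -> 1 < size E
                  & (u, v) \in port_ends p E].
- move: (E_in); rewrite inE => /predU1P[<-|E_Cs]; first by rewrite uv_E; left.
  by have [->|] := edge_c E u v E_Cs uv_E; [left; rewrite orbT | right].
- have [|uv_p|uv_p] := or3P (edge_c' u v uv); first by left.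
    right; exists p; rewrite (ends_same E C u v E_in (mem_head _ _) C_n0 uv_E uv_p).
    by split=> //; rewrite mem_head.
  have D_in' : D \in C :: Cs by rewrite inE D_in orbT.
  right; exists p; rewrite (ends_same E D u v E_in D_in' D_n0 uv_E uv_p).
  by split=> //; rewrite !inE eqxx orbT.
by right; exists p'; split=> //; rewrite !inE p'_used !orbT.
Qed.

(** * Chain trees under appending two bits *)

Lemma last_chain00 C : C != [::] ->
  last [::] (chain00 C) = rcons2 false false (last [::] C).
Proof. by case: C => // l R _; rewrite chain00E /= last_map. Qed.

Lemma head_chain00 C : C != [::] ->
  head [::] (chain00 C) = rcons2 true true (head [::] C).
Proof. by case: C. Qed.

Lemma last_chain01 C : C != [::] ->
  last [::] (chain01 C) = rcons2 false true (last [::] C).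
Proof. by case: C => // l R _; rewrite chain01E /= last_map. Qed.

Lemma head_chain01 C : C != [::] ->
  head [::] (chain01 C) = rcons2 false true (head [::] C).
Proof. by case: C. Qed.

Lemma last_chain10 C : 1 < size C ->
  last [::] (chain10 C) = rcons2 true false (last [::] C).
Proof. by case: C => [|l [|l' R]] // _; rewrite chain10E /= last_map. Qed.

Lemma size_chain00 C : C != [::] -> size (chain00 C) = (size C).+2.
Proof. by case: C => // l R _; rewrite chain00E /= size_map. Qed.

Lemma size_chain01 C : size (chain01 C) = size C.
Proof. by rewrite chain01E size_map. Qed.

Lemma size_chain10 C : 1 < size C -> size (chain10 C) = size C.
Proof. by case: C => [|l [|l' R]] // _; rewrite chain10E /= size_map. Qed.

Lemma chain_tree_used Cs us x p : chain_tree Cs us -> (x, p) \in us ->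
  x \in flatten Cs.
Proof.
have mem_last0 (C : seq (seq bool)) : C != [::] -> last [::] C \in C.
  by case: C => // l R _; rewrite /= mem_last.
elim=> // {Cs us} Cs us C D q _ IHCs C_n0 D_in D_gt1 _ _ _.
rewrite !inE mem_cat => /or3P[/eqP[-> _]|/eqP[-> _]|/IHCs->]; rewrite ?orbT //.
  by rewrite mem_last0.
apply/orP; right; apply/flattenP; exists D => //.
by apply: mem_last0; case: (D) D_gt1.
Qed.

Lemma flatten_block C : perm_eq (flatten (block C)) (append_bit (append_bit C)).
Proof.
apply: perm_trans (perm_append_bit (flatten_split_chain C)).
rewrite /block; elim: (split_chain C) => //= X Xs IHX.
rewrite flatten_cat perm_sym (permPl (append_bit_cat _ _)).
by rewrite perm_cat // perm_sym ?flatten_split_chain.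
Qed.

Lemma flatten_blocks Cs :
  perm_eq (flatten (flatten (map block Cs))) (append_bit (append_bit (flatten Cs))).
Proof.
elim: Cs => //= C Cs IHC; rewrite flatten_cat perm_sym.
rewrite (permPl (perm_append_bit (append_bit_cat _ _))) (permPl (append_bit_cat _ _)).
by rewrite perm_cat // perm_sym ?flatten_block.
Qed.

(* The links inside a block are chain00 - chain01 at [Some false], chain00 -
   chain10 at [Some true] and chain10 - chain11 at [None]. *)
Definition block_links (y : seq bool) :=
  [:: (rcons2 true true y, None); (rcons2 true false y, None);
      (rcons2 true false y, Some true); (rcons2 false false y, Some true);
      (rcons2 false true y, Some false); (rcons2 false false y, Some false)].

(** The tops of [chain10 C] and [chain11 C] lie over the second and third vertices of [C], both with
    [11] appended, hence are adjacent. As [chain11 C] may have a single vertex, or none, it is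
    attached as a leaf or not at all. *)
Lemma chain_tree_add11 Cs us C (y := last [::] C) :
    chain_tree Cs us -> 1 < size C -> sorted hadj C -> chain10 C \in Cs ->
    (rcons2 true false y, None) \notin us ->
  exists2 us', chain_tree ([seq X <- [:: chain11 C] | X != [::]] ++ Cs) us' &
    {subset us' <= [:: (rcons2 true true y, None), (rcons2 true false y, None) & us]}.
Proof.
rewrite {}/y; case: C => [|l [|l' [|l'' R]]] // tree_Cs _ sorted_C C_in free.
  by exists us => // q q_us; rewrite !inE q_us !orbT.
have E10 : last [::] (chain10 [:: l, l', l'' & R]) = rcons2 true false (last l'' R).
  by rewrite last_chain10.
eexists; first apply:
  (ChainTreeS (C := chain11 [:: l, l', l'' & R]) (p := None) tree_Cs _ C_in).
- by [].
- by rewrite size_chain10.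
- by [].
- by rewrite E10.
- rewrite chain11E chain10E /=; apply: hadj_rcons2.
  by rewrite hadj_sym; move: sorted_C => /= /and3P[].
- by rewrite E10 chain11E /= last_map.
Qed.

Lemma chain_tree_add Cs us C D p :
    chain_tree Cs us -> C != [::] -> D \in Cs -> 1 < size D ->
    (p != None -> 1 < size C) -> (last [::] D, p) \notin us ->
    hadj (port_vertex p C) (port_vertex p D) ->
  forall x z, last [::] C = x -> last [::] D = z ->
  chain_tree (C :: Cs) [:: (x, p), (z, p) & us].
Proof. by move=> *; subst; apply: ChainTreeS. Qed.

(** The ports in a block over [z] that are reserved for links to other blocks: each is used only if
    the corresponding port over [z] is. Port [None] reserves two, because linking a one-vertex chain
    consumes both. *)
Definition ports_kept (us us' : seq (seq bool * option bool)) (z : seq bool) :=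
  [/\ (rcons2 false false z, None) \in us' -> (z, None) \in us,
      (rcons2 false true z, None) \in us' -> (z, None) \in us,
      (rcons2 false true z, Some true) \in us' -> (z, Some false) \in us
    & (rcons2 true false z, Some false) \in us' -> (z, Some true) \in us].

(** No reserved port occurs in [block_links], so links inside a block preserve the invariant. *)
Lemma ports_kept_block_links us us1 us2 y z : ports_kept us us1 z ->
  {subset us2 <= block_links y ++ us1} -> ports_kept us us2 z.
Proof.
move=> [k1 k2 k3 k4] sub; split=> /sub;
  rewrite mem_cat !inE !xpair_eqE !rcons2_eq /= ?(andbF, andbT, orbF) /=; by [].
Qed.

(* A link between [C] and [D] at port [p] becomes a link between [entry p C] and
   [entry p D] at port [entry_port p]. *)
Definition entry (p : option bool) C :=
  match p with None => chain00 C | Some false => chain01 C | Some true => chain10 C end.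

(** The negation avoids the links inside the block, where [chain01] uses [Some false] and [chain10]
    uses [Some true]. *)
Definition entry_port (p : option bool) : option bool :=
  match p with None => None | Some b => Some (~~ b) end.

Definition entry_bits (p : option bool) :=
  match p with
  | None => rcons2 false false
  | Some false => rcons2 false true
  | Some true => rcons2 true false
  end.

Lemma last_entry p C : 1 < size C -> last [::] (entry p C) = entry_bits p (last [::] C).
Proof.
move=> C_gt1; have C_n0 : C != [::] by case: (C) C_gt1.
by case: p => [[]|] /=; rewrite ?last_chain00 ?last_chain01 ?last_chain10.
Qed.

(** Once one chain of the block is in the tree, the rest follows through the links inside the block;
    their ports are free because only the entry port has been used over [y]. *)
Lemma chain_tree_complete Cs us C p (y := last [::] C) :
    chain_tree (entry p C :: Cs) us -> 1 < size C -> sorted hadj C ->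
    (forall a b q, (rcons2 a b y, q) \in us ->
       (rcons2 a b y, q) = (entry_bits p y, entry_port p)) ->
  exists Cs' us', [/\ chain_tree Cs' us', perm_eq Cs' (block C ++ Cs) &
    {subset us' <= block_links y ++ us}].
Proof.
rewrite {}/y => tree_C C_gt1 sorted_C; move Ey: (last [::] C) => y free.
have C_n0 : C != [::] by case: (C) C_gt1.
have [n00 n01 n10] : [/\ chain00 C != [::], chain01 C != [::] & chain10 C != [::]].
  by rewrite -!size_eq0 size_chain00 // size_chain01 size_chain10 //; split; lia.
have [g00 g01 g10] : [/\ 1 < size (chain00 C), 1 < size (chain01 C) & 1 < size (chain10 C)].
  by rewrite size_chain00 // size_chain01 size_chain10.
have [l00 l01 l10] := And3 (last_chain00 C_n0) (last_chain01 C_n0) (last_chain10 C_gt1).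
rewrite Ey in l00 l01 l10.
have h01 : hadj (rcons2 false false y) (rcons2 false true y) by apply: hadj_rcons2r.
have h10 : hadj (rcons2 false false y) (rcons2 true false y) by apply: hadj_rcons2l.
have freeN a b q : (a, b, q) != (p == Some true, p == Some false, entry_port p) ->
    (rcons2 a b y, q) \notin us.
  apply: contraNN => /free[/eqP E ->]; move: E; rewrite /entry_bits.
  by case: (p) => [[]|]; rewrite rcons2_eq eqxx andTb => /andP[/eqP-> /eqP->].
(* [chain11 C] always comes last, attached to [chain10 C]; [drop 2] leaves out the two ports of that
   link. It remains to place the other three chains. *)
have finish Ds vs : chain_tree Ds vs -> chain10 C \in Ds ->
    perm_eq Ds [:: chain00 C, chain01 C, chain10 C & Cs] ->
    {subset vs <= drop 2 (block_links y) ++ us} ->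
    exists Cs' us', [/\ chain_tree Cs' us', perm_eq Cs' (block C ++ Cs) &
      {subset us' <= block_links y ++ us}].
  move=> tree_D D_in perm_D sub_vs.
  have := chain_tree_add11 tree_D C_gt1 sorted_C D_in; rewrite Ey => -[|vs' tree' sub'].
    apply/negP => /sub_vs; rewrite mem_cat !inE !xpair_eqE !rcons2_eq !andbF /=.
    by apply/negP/freeN; case: (p) => [[]|].
  exists ([seq X <- [:: chain11 C] | X != [::]] ++ Ds), vs'; split=> //.
    rewrite block2 //; apply/permP => q; have /permP/(_ q) := perm_D.
    by rewrite !count_cat /= ?count_cat /=; lia.
  move=> q /sub'; rewrite in_cons in_cons mem_cat => /or3P[/eqP->|/eqP->|/sub_vs].
  - by rewrite mem_head.
  - by rewrite !inE eqxx orbT.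
  - by rewrite mem_cat => /orP[/mem_drop ->|->]; rewrite ?orbT.
(* The two links at [chain00] are added outward from the entry chain, so the orders are [10], [00],
   [01], then [01], [00], [10], then [00], [01], [10]. *)
case: p tree_C free freeN => [[]|] /= tree_C free freeN.
- have tree1 : chain_tree [:: chain00 C, chain10 C & Cs]
      [:: (rcons2 false false y, Some true), (rcons2 true false y, Some true) & us].
    apply: (chain_tree_add tree_C n00 (mem_head _ _) g10 (fun=> g00) _ _ l00 l10).
      by rewrite l10 freeN.
    by rewrite /= l00 l10.
  have tree2 : chain_tree [:: chain01 C, chain00 C, chain10 C & Cs]
      [:: (rcons2 false true y, Some false), (rcons2 false false y, Some false),
          (rcons2 false false y, Some true), (rcons2 true false y, Some true) & us].
    apply: (chain_tree_add tree1 n01 (mem_head _ _) g00 (fun=> g01) _ _ l01 l00).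
      by rewrite l00 !inE !xpair_eqE /= !andbF freeN.
    by rewrite /= l00 l01 hadj_sym.
  apply: (finish _ _ tree2).
  + by rewrite !inE eqxx ?orbT.
  + by apply/permP => q /=; lia.
  + by move=> q; rewrite !inE; repeat case/orP; move=> ->; rewrite ?orbT.
- have tree1 : chain_tree [:: chain00 C, chain01 C & Cs]
      [:: (rcons2 false false y, Some false), (rcons2 false true y, Some false) & us].
    apply: (chain_tree_add tree_C n00 (mem_head _ _) g01 (fun=> g00) _ _ l00 l01).
      by rewrite l01 freeN.
    by rewrite /= l00 l01.
  have tree2 : chain_tree [:: chain10 C, chain00 C, chain01 C & Cs]
      [:: (rcons2 true false y, Some true), (rcons2 false false y, Some true),
          (rcons2 false false y, Some false), (rcons2 false true y, Some false) & us].
    apply: (chain_tree_add tree1 n10 (mem_head _ _) g00 (fun=> g10) _ _ l10 l00).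
      by rewrite l00 !inE !xpair_eqE /= !andbF freeN.
    by rewrite /= l00 l10 hadj_sym.
  apply: (finish _ _ tree2).
  + by rewrite !inE eqxx ?orbT.
  + by apply/permP => q /=; lia.
  + by move=> q; rewrite !inE; repeat case/orP; move=> ->; rewrite ?orbT.
- have tree1 : chain_tree [:: chain01 C, chain00 C & Cs]
      [:: (rcons2 false true y, Some false), (rcons2 false false y, Some false) & us].
    apply: (chain_tree_add tree_C n01 (mem_head _ _) g00 (fun=> g01) _ _ l01 l00).
      by rewrite l00 freeN.
    by rewrite /= l00 l01 hadj_sym.
  have tree2 : chain_tree [:: chain10 C, chain01 C, chain00 C & Cs]
      [:: (rcons2 true false y, Some true), (rcons2 false false y, Some true),
          (rcons2 false true y, Some false), (rcons2 false false y, Some false) & us].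
    apply: (chain_tree_add tree1 n10 _ g00 (fun=> g10) _ _ l10 l00).
      by rewrite !inE eqxx orbT.
      by rewrite l00 !inE !xpair_eqE /= !andbF freeN.
    by rewrite /= l00 l10 hadj_sym.
  apply: (finish _ _ tree2).
  + by rewrite !inE eqxx ?orbT.
  + by apply/permP => q /=; lia.
  + by move=> q; rewrite !inE; repeat case/orP; move=> ->; rewrite ?orbT.
Qed.

(** Blocks are added in the order in which the tree is built. The invariant [ports_kept] ensures
    that a free port of [D] still has a free counterpart in the block of [D]. *)
Lemma chain_tree_block Cs us : chain_tree Cs us -> uniq (flatten Cs) ->
    {in Cs, forall C, sorted hadj C} ->
  exists Cs' us', [/\ chain_tree Cs' us', perm_eq Cs' (flatten (map block Cs)) &
    {in Cs, forall D, 1 < size D -> ports_kept us us' (last [::] D)}].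
Proof.
elim=> {Cs us}
  [C C_n0 _ sorted_C|Cs us C D p tree_Cs IHCs C_n0 D_in D_gt1 p_gt1 p_free p_adj].
  have {}sorted_C := sorted_C C (mem_head _ _).
  case: (ltnP 1 (size C)) => [C_gt1|C_le1].
    have tree1 : chain_tree [:: entry None C] [::].
      by apply: ChainTree1; case: (C) C_n0.
    have [//|Cs' [us' [tree' perm' sub']]] := chain_tree_complete tree1 C_gt1 sorted_C.
    exists Cs', us'; split=> //.
    by move=> D _ _; apply: ports_kept_block_links sub'.
  case: C C_n0 C_le1 {sorted_C} => [|l []] // _ _.
  (* The block of a one-vertex chain consists of two chains, whose tops [l] with [01] and [l] with
     [11] are adjacent. *)
  exists [:: chain01 [:: l]; chain00 [:: l]].
  exists [:: (rcons2 false true l, None); (rcons2 false false l, None)]; split.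
  - apply: (chain_tree_add (D := chain00 [:: l])) => //; first exact: ChainTree1.
      exact: mem_head.
    exact: (hadj_rcons2l false true l).
  - exact: (permEl (perm_catC [:: chain01 [:: l]] [:: chain00 [:: l]])).
  - by move=> D; rewrite inE => /eqP ->.
rewrite /= cat_uniq => /and3P[C_uniq /hasPn disj uniq_Cs] sorted_CCs.
have [//||Cs' [us' [tree' perm' kept]]] := IHCs.
  by move=> E E_in; rewrite sorted_CCs // inE E_in orbT.
have sorted_C := sorted_CCs C (mem_head _ _).
set y := last [::] C; set z := last [::] D.
have y_C : y \in C by rewrite /y; case: (C) C_n0 => // l R _; rewrite /= mem_last.
have z_Cs : z \in flatten Cs.
  apply/flattenP; exists D => //; rewrite /z.
  by case: (D) D_gt1 => // l R _; rewrite /= mem_last.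
have y_Cs : y \notin flatten Cs by apply: contraL y_C; apply: disj.
have yz : (y == z) = false by apply: contraNF y_Cs => /eqP ->.
(* The bottom [y] lies on no chain of the old tree, so nothing over it lies on a chain of the new
   one. *)
have fresh a b q : (rcons2 a b y, q) \notin us'.
  apply: contraNN y_Cs => /(chain_tree_used tree').
  by rewrite (perm_mem (perm_flatten perm')) (perm_mem (flatten_blocks Cs)) mem_rcons2.
have kept' E : E \in C :: Cs -> 1 < size E -> ports_kept us us' (last [::] E).
  rewrite inE => /predU1P[-> _|]; last exact: kept.
  by split; rewrite (negPf (fresh _ _ _)).
have D_n0 : D != [::] by case: (D) D_gt1.
have block_in X : X \in block D -> X \in Cs'.
  by move=> X_in; rewrite (perm_mem perm'); apply/flatten_mapP; exists D.
have [k1 k2 k3 k4] := kept D D_in D_gt1.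
case: (ltnP 1 (size C)) => [C_gt1|C_le1]; last first.
  have Ep : p = None by case: (p) p_gt1 => // b /(_ isT); rewrite ltnNge C_le1.
  subst p; case: C C_n0 C_le1 @y
    {sorted_C sorted_CCs y_C C_uniq disj p_gt1 kept'} y_Cs yz fresh p_adj
    => [|l []] // _ _ y y_Cs yz fresh p_adj.
  have tree1 : chain_tree (chain00 [:: l] :: Cs')
      [:: (rcons2 false false l, None), (rcons2 false false z, None) & us'].
    apply: (chain_tree_add tree' _ (D := chain00 D)) => //.
    - by rewrite block_in // block2 // mem_head.
    - by rewrite size_chain00.
    - by rewrite last_chain00 //; apply: contraNN p_free.
    - by rewrite /= head_chain00 //; apply: hadj_rcons2.
    - by rewrite last_chain00.
  (* [chain01 [:: l]] has one vertex and can be linked only at [None], a port that [chain00 [:: l]]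
     has already spent; so it is linked to [chain01 D] instead. *)
  have tree2 : chain_tree [:: chain01 [:: l], chain00 [:: l] & Cs']
      [:: (rcons2 false true l, None), (rcons2 false true z, None),
          (rcons2 false false l, None), (rcons2 false false z, None) & us'].
    apply: (chain_tree_add tree1 _ (D := chain01 D)) => //.
    - by rewrite inE block_in ?orbT // block2 // !inE eqxx orbT.
    - by rewrite size_chain01.
    - rewrite last_chain01 // !inE !xpair_eqE !rcons2_eq !andbF /=.
      by apply: contraNN p_free.
    - by rewrite /= head_chain01 //; apply: hadj_rcons2.
    - by rewrite last_chain01.
  eexists; eexists; split; first exact: tree2.
    by rewrite block1 (perm_catCA [:: _] [:: _] Cs') /= !perm_cons.
  move=> E; rewrite inE => /predU1P[-> //|E_in E_gt1].
  have [e1 e2 e3 e4] := kept E E_in E_gt1.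
  split; rewrite !inE !xpair_eqE !rcons2_eq /= ?(andbF, andbT, orbF) /=.
  - by case/or3P => [->|->|/e1->]; rewrite ?orbT.
  - by case/or3P => [->|->|/e2->]; rewrite ?orbT.
  - by move/e3->; rewrite ?orbT.
  - by move/e4->; rewrite ?orbT.
have tree1 : chain_tree (entry p C :: Cs')
    [:: (entry_bits p y, entry_port p), (entry_bits p z, entry_port p) & us'].
  apply: (chain_tree_add tree' _ (D := entry p D)).
  - rewrite -size_eq0 -lt0n; case: (p) => [[]|] /=;
      by rewrite ?size_chain00 ?size_chain01 ?size_chain10 // ltnW.
  - by rewrite block_in // block2 //; case: (p) => [[]|]; rewrite !inE eqxx ?orbT.
  - by case: (p) => [[]|] /=; rewrite ?size_chain00 ?size_chain01 ?size_chain10.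
  - by case: (p) => [[]|] //= _; rewrite ?size_chain01 ?size_chain10.
  - rewrite last_entry //; apply: contraNN p_free.
    by case: (p) => [[]|]; [exact: k4 | exact: k3 | exact: k1].
  - have := p_adj; case: (p) => [b|] /=; last first.
      by rewrite !head_chain00 //; apply: hadj_rcons2.
    rewrite !(last_entry (Some b)) // => ?.
    by case: b => /=; apply: hadj_rcons2.
  - exact: last_entry.
  - exact: last_entry.
have [|Cs2 [us2 [tree2 perm2 sub2]]] := chain_tree_complete tree1 C_gt1 sorted_C.
  move=> a b q; rewrite !inE => /or3P[/eqP //|/eqP[+ _]|]; last first.
    by rewrite (negPf (fresh _ _ _)).
  by move/eqP; rewrite /entry_bits; case: (p) => [[]|]; rewrite rcons2_eq yz.
exists Cs2, us2; split=> //; first by rewrite (permPl perm2) perm_cat2l.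
move=> E E_in E_gt1; apply: ports_kept_block_links sub2.
have [e1 e2 e3 e4] := kept' E E_in E_gt1.
case: (p) => [[]|]; split; rewrite !inE !xpair_eqE /= ?rcons2_eq ?(andbF, andbT, orbF) //=;
  do ?case/orP; first [by move=> ->; rewrite ?orbT | by move/e1 ->; rewrite ?orbT
    | by move/e2 ->; rewrite ?orbT | by move/e3 ->; rewrite ?orbT
    | by move/e4 ->; rewrite ?orbT].
Qed.

(** * Trees in all dimensions and transfer to tuples *)

Lemma gk_chainsSS n : gk_chains n.+2 = flatten (map block (gk_chains n)).
Proof.
rewrite [LHS]/=; elim: (gk_chains n) => //= C Cs IHC.
by rewrite map_cat flatten_cat IHC.
Qed.

Lemma gk_chains_tree n : exists Cs us, chain_tree Cs us /\ perm_eq Cs (gk_chains n).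
Proof.
(* The dimension grows by two at a time, and [Q_0] and [Q_1] are single chains. *)
elim/ltn_ind: n => -[|[|n]] IHn.
- by exists (gk_chains 0), [::]; split=> //; apply: ChainTree1.
- by exists (gk_chains 1), [::]; split=> //; apply: ChainTree1.
have [Cs [us [tree_Cs perm_Cs]]] := IHn n (leqnSn _).
have [||Cs' [us' [tree' perm' _]]] := chain_tree_block tree_Cs.
- by rewrite (perm_uniq (perm_flatten perm_Cs)) gk_chains_uniq.
- move=> C; rewrite (perm_mem perm_Cs) => /gk_chains_greene_kleitman.
  exact: greene_kleitman_sorted.
exists Cs', us'; split=> //; rewrite (permPl perm') gk_chainsSS.
exact/perm_flatten/perm_map.
Qed.

Lemma hadj_cycle_gk_chains n : exists c,
  [/\ perm_eq c (flatten (gk_chains n.+2)), cycle hadj c &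
      forall X u v, X \in gk_chains n.+2 -> (u, v) \in pairs X -> edge c u v].
Proof.
have [Cs [us [tree_Cs perm_Cs]]] := gk_chains_tree n.
have [||c [perm_c cycle_c edge_c]] := chain_tree_cycle tree_Cs.
- by rewrite (perm_uniq (perm_flatten perm_Cs)) gk_chains_uniq.
- move=> C; rewrite (perm_mem perm_Cs) => /gk_chains_greene_kleitman.
  exact: greene_kleitman_sorted.
exists c; split=> // [|X u v].
  rewrite gk_chainsSS (permPl perm_c) perm_sym (permPl (flatten_blocks _)).
  by do 2 apply: perm_append_bit; rewrite perm_flatten // perm_sym.
rewrite gk_chainsSS => /flatten_mapP[C C_in X_in].
by apply: edge_c X_in; rewrite (perm_mem perm_Cs).
Qed.

Lemma lift_tuples n (c : seq (seq bool)) : all (fun x => size x == n) c ->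
  exists c' : seq (vertex n), map val c' = c.
Proof.
elim: c => [|x c IHc] /=; first by exists [::].
by case/andP => szx /IHc[c' <-]; exists (Tuple szx :: c').
Qed.

Lemma hadj_qadj n (x y : vertex n) : hadj x y -> qadj x y.
Proof.
case/hadjP => j; rewrite size_tuple => ltj Ey; rewrite /qadj.
apply/cards1P; exists (Ordinal ltj); apply/setP => i.
rewrite !inE -val_eqE /= !(tnth_nth false) Ey nth_flips ?size_tuple //.
by case: (nat_of_ord i == j); case: (nth _ _ _).
Qed.

Lemma val_flip n (x : vertex n) j : val (flip x j) = flips x j.
Proof.
apply: (@eq_from_nth _ false) => [|i]; first by rewrite size_tuple size_flips size_tuple.
rewrite size_tuple => lti; rewrite nth_flips ?size_tuple //.
by rewrite -(tnth_nth false _ (Ordinal lti)) tnth_mktuple (tnth_nth false).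
Qed.

Lemma gk_edge_pairs n (x y : vertex n) : gk_edge x y ->
  exists2 C, C \in gk_chains n &
    ((val x, val y) \in pairs C) || ((val y, val x) \in pairs C).
Proof.
have : val x \in flatten (gk_chains n) by rewrite mem_gk_chains size_tuple.
case/flattenP => C C_in x_C; have gkC := gk_chains_greene_kleitman C_in.
rewrite /gk_edge /gk_up /gk_down /unmatched0 /unmatched1 => edge_xy; exists C => //.
case/orP: edge_xy.
  case E: (bscan x 0 [::]).1 => [|i l] // /eqP[<-]; rewrite val_flip.
  by rewrite (greene_kleitman_up gkC x_C E) orbT.
case E: (bscan x 0 [::]).2 => [|i l] // /eqP[<-]; rewrite val_flip.
by rewrite (greene_kleitman_down gkC x_C E).
Qed.

Theorem theorem3 (n : nat) : 2 <= n ->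
  exists c : seq (vertex n),
    hamilton_cycle c /\
    (forall x y : vertex n, gk_edge x y -> cycle_edge c x y).
Proof.
case: n => [|[|n]] // _.
have [c [perm_c cycle_c edge_c]] := hadj_cycle_gk_chains n.
have mem_c x : (x \in c) = (size x == n.+2) by rewrite (perm_mem perm_c) mem_gk_chains.
have uniq_c : uniq c by rewrite (perm_uniq perm_c) gk_chains_uniq.
have [|c' Ec] := @lift_tuples n.+2 c; first by apply/allP => x; rewrite mem_c.
rewrite -{}Ec in cycle_c edge_c mem_c uniq_c {perm_c}.
have mem_c' x : x \in c' by rewrite -(mem_map val_inj) mem_c size_tuple.
have uniq_c' : uniq c' by rewrite -(map_inj_uniq val_inj).
exists c'; split.
  apply/and3P; split=> //; first by apply/allP => x _; apply: mem_c'.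
  by rewrite cycle_map in cycle_c; apply: sub_cycle cycle_c => x y; apply: hadj_qadj.
move=> x y /gk_edge_pairs[C C_in xy]; rewrite /cycle_edge !mem_c' /=.
have: edge (map val c') (val x) (val y).
  by case/orP: xy => /(edge_c _ _ _ C_in) //; rewrite edgeC.
by case/orP => /(next_cpairs uniq_c)/eqP; rewrite (next_map val_inj) // val_eqE => ->;
  rewrite ?orbT.
Qed.
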